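(* Consider the model $Y=B_0+Z\,B_1+\mathbf W^\top\mathbf B_2$, where $Z$ is a binary regressor with support $\{0,1\}$, $\mathbf W$ is an $\mathbb R^{p-2}$-valued regressor, and the random coefficient vector $\mathbf A=(B_0,B_1,\mathbf B_2^\top)^\top\in\mathbb R^p$ is independent of $(Z,\mathbf W^\top)^\top$ and has finite second moments. Suppose that the support of $(Z,\mathbf W^\top)^\top$ has product structure, i.e. equals $\{0,1\}\times\operatorname{supp}(\mathbf W)$, and that $\operatorname{supp}(\mathbf W)$ contains a Cartesian product with at least three points in each coordinate (so only $Z$ is binary). 1. If $\operatorname{Var}(B_0)\ne\operatorname{Var}(B_0+B_1)$, or if $\operatorname{Cov}(B_1;\mathbf B_2)$ is not the zero vector, then $\operatorname{Var}(B_1)>0$. 2. Conversely, suppose that $\operatorname{Var}(B_0)=\operatorname{Var}(B_0+B_1)$ and that $\operatorname{Cov}(B_1;\mathbf B_2)=\mathbf 0_{p-2}$. (a) If $\operatorname{Cov}\big((B_0,\mathbf B_2^\top)^\top\big)$ is degenerate (singular) and its kernel contains a vector with non-zero first coordinate, then necessarily $\operatorname{Var}(B_1)=0$. (b) If $\operatorname{Cov}\big((B_0,\mathbf B_2^\top)^\top\big)$ has full rank, then the upper bound $\sup_{\Sigma\in\mathcal S}\Sigma_{22}$ for $\operatorname{Var}(B_1)$ is strictly positive.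
   Context: $\operatorname{Cov}(\mathbf C)$ denotes the covariance matrix of a random vector $\mathbf C$, and $\operatorname{Cov}(\mathbf C;\mathbf D)$ contains the cross-covariances of $\mathbf C$ and $\mathbf D$. The set $\mathcal S$ of covariance matrices of $\mathbf A$ consistent with the conditional second moments of $Y$ is $$\mathcal S=\big\{\Sigma\in\mathbb R^{p\times p}:\ \Sigma\text{ symmetric positive semi-definite and }(1,z,\mathbf w^\top)\,\Sigma\,(1,z,\mathbf w^\top)^\top=\operatorname{Var}(Y\mid Z=z,\mathbf W=\mathbf w)\ \ \forall (z,\mathbf w)\in\operatorname{supp}(Z,\mathbf W)\big\},$$ where, by independence, $\operatorname{Var}(Y\mid Z=z,\mathbf W=\mathbf w)=(1,z,\mathbf w^\top)\operatorname{Cov}(\mathbf A)(1,z,\mathbf w^\top)^\top$. The index $2$ in $\Sigma_{22}$ corresponds to the coefficient $B_1$, so that $\inf_{\Sigma\in\mathcal S}\Sigma_{22}\le\operatorname{Var}(B_1)\le\sup_{\Sigma\in\mathcal S}\Sigma_{22}$. The support of a random vector is the smallest closed set of probability one. *)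

(* Defs.v *)
From HB Require Import structures.
From mathcomp Require Import all_boot all_order all_algebra.
From mathcomp Require Import all_classical all_reals all_analysis.

Set Implicit Arguments.
Unset Strict Implicit.
Unset Printing Implicit Defensive.

Import Order.TTheory GRing.Theory Num.Theory.
Import numFieldNormedType.Exports.

Local Open Scope classical_set_scope.
Local Open Scope ring_scope.

Notation borel V := (g_sigma_algebraType (@open V)).
Notation borel_set := (@open _).-sigma.-measurable.

Section random_vectors.
Context d (T : measurableType d) (R : realType) (P : probability T R).

Definition random_vector (V : ptopologicalType) (X : T -> V) : Prop :=
  measurable_fun [set: T] (X : T -> borel V).

(* The smallest closed set of probability one. *)
Definition supp (V : ptopologicalType) (X : T -> V) : set V :=
  \bigcap_(C in [set C | closed C /\ P (X @^-1` C) = 1%E]) C.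

Definition independent (V V' : ptopologicalType) (A : T -> V) (X : T -> V') :=
  forall (E : set V) (F : set V'), borel_set E -> borel_set F ->
    P (A @^-1` E `&` X @^-1` F) = (P (A @^-1` E) * P (X @^-1` F))%E.

Definition crosscovmx m n (C : T -> 'rV[R]_m) (D : T -> 'rV[R]_n) :
    'M[R]_(m, n) :=
  \matrix_(i, j)
    fine (covariance P (fun t => C t ord0 i) (fun t => D t ord0 j)).

Definition covmx n (C : T -> 'rV[R]_n) : 'M[R]_n := crosscovmx C C.

Definition finite_second_moments n (C : T -> 'rV[R]_n) : Prop :=
  forall i, (fun t => C t ord0 i) \in Lfun P 2%:E.

(* [g] is a version of x |-> E[U | X = x].  The defining identity is required
   over relatively compact Borel sets only, as U need not be integrable (here
   Y has conditional moments given (Z, W) even if W itself has no moments);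
   for V = R^n and integrable U this is the usual definition. *)
Definition cond_exp_version (V : ptopologicalType) (X : T -> V) (U : T -> R)
    (g : V -> R) : Prop :=
  measurable_fun [set: borel V] (g : borel V -> R) /\
  forall B : set V, borel_set B -> (exists2 K, compact K & B `<=` K) ->
    [/\ P.-integrable (X @^-1` B) (fun t => (U t)%:E),
        P.-integrable (X @^-1` B) (fun t => (g (X t))%:E) &
        (\int[P]_(t in X @^-1` B) (U t)%:E =
         \int[P]_(t in X @^-1` B) (g (X t))%:E)%E].

(* E[U | X = x]: the version that is continuous on supp X, which makes the value
   at every single point x of supp X meaningful.  For V = R^n two such versions
   agree on supp X; the value is junk off supp X, or if there is none. *)
Definition cond_exp (V : ptopologicalType) (X : T -> V) (U : T -> R) : V -> R :=
  xget (fun=> 0)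
    [set g | cond_exp_version X U g /\ {within supp X, continuous g}].

Definition cond_var (V : ptopologicalType) (X : T -> V) (U : T -> R) (x : V)
    : R :=
  cond_exp X (fun t => (U t - cond_exp X U x) ^+ 2) x.

End random_vectors.

Section random_coefficients.
Context (R : realType).

Definition symmetric_psd n (S : 'M[R]_n) : Prop :=
  S^T = S /\ forall x : 'rV[R]_n, 0 <= (x *m S *m x^T) ord0 ord0.

(* (a, c^T)^T, and (a, b, c^T)^T in R^p with p = q + 2 split as 1 + (1 + q);
   vectors are stored as rows. *)
Definition vec2 q (a : R) (c : 'rV[R]_q) : 'rV[R]_(1 + q) := row_mx a%:M c.

Definition vec3 q (a b : R) (c : 'rV[R]_q) : 'rV[R]_(1 + (1 + q)) :=
  vec2 a (vec2 b c).

(* Position of the coefficient B_1 in A; the "index 2" of Sigma_22. *)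
Definition idxB1 q : 'I_(1 + (1 + q)) := rshift 1 (lshift q ord0).

Definition consistent_cov d (T : measurableType d) (P : probability T R) q
    (Y Z : T -> R) (W : T -> 'rV[R]_q) : set 'M[R]_(1 + (1 + q)) :=
  [set S | symmetric_psd S /\
    forall z w, supp P (fun t => vec2 (Z t) (W t)) (vec2 z w) ->
      (vec3 1 z w *m S *m (vec3 1 z w)^T) ord0 ord0 =
      cond_var P (fun t => vec2 (Z t) (W t)) Y (vec2 z w)].

Definition contains_3pt_product q (D : set 'rV[R]_q) : Prop :=
  exists G : 'I_q -> set R, (forall i, (`I_3 #<= G i)%card) /\
    [set w : 'rV[R]_q | forall i, G i (w ord0 i)] `<=` D.

End random_coefficients.

(* Main.v *)
Require Import Defs.
From mathcomp Require Import all_boot all_order all_algebra.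
From mathcomp Require Import all_classical all_reals all_analysis.
From mathcomp Require Import measurable_realfun ring lra.
Import Order.TTheory GRing.Theory Num.Theory.
Import numFieldNormedType.Exports.
Local Open Scope classical_set_scope.
Local Open Scope ring_scope.

(** The two claims about Var(B1) itself are second-moment algebra.  If
    Var(B1) = 0 then B1 is uncorrelated with every square-integrable variable
    ([covariance_var0]), which gives part 1 by contraposition.  For part 2(a), a
    kernel vector (a, c) of Cov(B0, B2) with a <> 0 makes a B0 + c.B2 almost
    surely constant, hence uncorrelated with B1; as Cov(B1; B2) = 0 this forces
    Cov(B0, B1) = 0, and Var(B0) = Var(B0 + B1) leaves Var(B1) = 0
    ([kernel_var0]).

    Part 2(b) is about non-identification: Z is binary, so z^2 = z on its
    support, and the monomials z^2 and z cannot be told apart there.  Under the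
    hypotheses of part 2 the conditional variance of Y at (z, w) does not depend
    on z: it is Q(1, w), where Q is the quadratic form of K = Cov(B0, B2)
    ([variance_slice]).  For l > 0 the form
      Q(a, c) - l a^2 + l (a - 2 b)^2
    takes the value Q(1, w) at (1, z, w) for both z = 0 and z = 1, because then
    (1 - 2 z)^2 = 1; its coefficient at b^2 is 4 l > 0.  It is positive
    semi-definite as soon as Q dominates l a^2, which holds for small l when K
    is nonsingular ([qform_full_rank]).  The matrix of this form ([tilt]) is a
    point of the identified set with Sigma_22 = 4 l.

    What remains is that the conditional variance of Y given X = (Z, W), read
    at a point x of the support of X, is the variance of A.(1, x)
    ([cond_var_linear]).  This rests on two facts.  First, a version of a
    conditional expectation that is continuous on the support is determined
    there ([cond_expE]), since every neighbourhood of a point of the support has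
    positive probability and the support carries all the mass.  Secondly, for
    a finite sum of products a(A) p(X) with A and X independent, such a version
    is obtained by freezing X ([cond_exp_freeze]): Fubini's theorem for the
    joint law, which is the product of the laws, factors the integrals. *)

Set Implicit Arguments.
Unset Strict Implicit.
Unset Printing Implicit Defensive.

(** * Borel sets and the support of a random vector *)

Lemma open_borel (V : ptopologicalType) (U : set V) : open U -> borel_set U.
Proof. by move=> oU; exact: sub_sigma_algebra. Qed.

Lemma closed_borel (V : ptopologicalType) (C : set V) :
  closed C -> borel_set C.
Proof.
move=> cC; rewrite -(setCK C).
by apply: (@measurableC _ (borel V)); apply: open_borel; exact: closed_openC.
Qed.

Lemma continuous_borel_measurable (R : realType) (V : ptopologicalType)
    (f : V -> R) :
  continuous f -> measurable_fun [set: borel V] (f : borel V -> R).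
Proof.
move=> /continuousP cf; apply: (measurability _ (RGenOpens.measurableE R)).
move=> _ [_ [a [b ->] <-]]; rewrite setTI; apply: open_borel.
exact/cf/interval_open.
Qed.

Section support.
Context d (T : measurableType d) (R : realType) (P : probability T R).

Lemma random_vector_measurable (V : ptopologicalType) (X : T -> V) (B : set V) :
  random_vector X -> borel_set B -> measurable (X @^-1` B).
Proof. by move=> mX mB; rewrite -[_ @^-1` _]setTI; exact: mX. Qed.

Lemma supp_open_neq0 (V : ptopologicalType) (X : T -> V) (U : set V) (x : V) :
  random_vector X -> supp P X x -> open U -> U x -> P (X @^-1` U) != 0%E.
Proof.
move=> mX sx oU Ux; apply/eqP => PU0.
suff : (~` U) x by [].
apply: sx; split; first exact: open_closedC.
rewrite -preimage_setC probability_setC ?PU0 ?sube0//.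
by apply: random_vector_measurable => //; exact: open_borel.
Qed.

Lemma supp_closed (V : ptopologicalType) (X : T -> V) : closed (supp P X).
Proof. by apply: closed_bigI => C []. Qed.

Lemma rat_row_dense n (y : 'rV[R]_n) (e : R) : 0 < e ->
  exists r : 'rV[rat]_n, ball (map_mx (@ratr R) r) e y.
Proof.
move=> e0.
have /choice[r Hr] : forall i,
    exists q : rat, y ord0 i - e < ratr q < y ord0 i + e.
  move=> i; have /rat_in_itvoo[q] : y ord0 i - e < y ord0 i + e.
    by rewrite ltrBlDr -addrA ltrDl addr_gt0.
  by rewrite in_itv /=; exists q.
exists (\row_i r i); split=> // i j.
rewrite !mxE ord1 /ball/= /ball_ ltr_distlC.
by have /andP[h1 h2] := Hr j; rewrite ltrBlDr h2 -ltrBlDr h1.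
Qed.

(** The complement of the support is a union of null open sets; separability of
    R^n makes countably many of them, rational balls, suffice. *)
Lemma supp_null n (X : T -> 'rV[R]_n) : random_vector X ->
  P (X @^-1` ~` supp P X) = 0%E.
Proof.
move=> mX.
pose Bl (p : 'rV[rat]_n * nat) : set 'rV[R]_n :=
  ball (map_mx (@ratr R) p.1) p.2.+1%:R^-1.
(* The null preimages of rational balls, enumerated by centres and radii. *)
pose F k := if unpickle k is Some p then
  (if `[< P (X @^-1` Bl p) = 0%E >] then X @^-1` Bl p else set0) else set0.
have mBl p : measurable (X @^-1` Bl p).
  apply: random_vector_measurable => //; apply: open_borel; exact: ball_open.
have F0 : P.-negligible (\bigcup_k F k).
  apply: negligible_bigcup => k; rewrite /F.
  case: unpickle => [p|]; last exact: negligible_set0.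
  case: asboolP => [p0|_]; last exact: negligible_set0.
  by exists (X @^-1` Bl p); split.
apply: measure_negligible.
  apply: random_vector_measurable => //; apply: open_borel.
  by apply: closed_openC; exact: supp_closed.
apply: negligibleS F0 => t /= Xt.
have [C [cC PC] nCX] : exists2 C, closed C /\ P (X @^-1` C) = 1%E & ~ C (X t).
  apply: contrapT => h; apply: Xt => C hC.
  by apply: contrapT => ?; apply: h; exists C.
have /nbhs_ballP[e /= e0 eC] : nbhs (X t) (~` C).
  by apply: open_nbhs_nbhs; split => //; exact: closed_openC.
have [m me] : exists m : nat, m.+1%:R^-1 < e / 2.
  have := near_infty_natSinv_lt (PosNum (divr_gt0 e0 (ltr0n R 2))).
  by case=> m _ /(_ m (leqnn _)) /= h; exists m.
have m0 : 0 < m.+1%:R^-1 :> R by rewrite invr_gt0.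
have [r rX] := rat_row_dense (X t) m0.
exists (pickle (r, m)) => //; rewrite /F pickleK.
case: asboolP => [//|]; case.
apply: subset_measure0 (_ : P (X @^-1` ~` C) = 0%E) => //.
- apply: random_vector_measurable => //; apply: open_borel; exact: closed_openC.
- move=> u /= ru; apply: eC.
  rewrite [e]splitr; apply: (@ball_triangle _ _ (map_mx (@ratr R) r)).
    by apply: ball_sym; apply: le_ball rX; exact: ltW.
  by apply: le_ball ru; exact: ltW.
- rewrite -preimage_setC probability_setC ?PC ?subee//.
  by apply: random_vector_measurable => //; exact: closed_borel.
Qed.

End support.

(** * Uniqueness of continuous conditional expectations on the support *)

Section cond_exp_value.
Context d (T : measurableType d) (R : realType) (P : probability T R).

(** If g x > g' x at a point x of the support, then g > g' on the part B of the
    support inside some ball around x.  The defining identity over the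
    relatively compact set B forces B to be null, hence so is the ball, which
    contradicts that x lies in the support. *)
Lemma cond_exp_version_le n (X : T -> 'rV[R]_n) (U : T -> R)
    (g g' : 'rV[R]_n -> R) :
  random_vector X ->
  cond_exp_version P X U g -> {within supp P X, continuous g} ->
  cond_exp_version P X U g' -> {within supp P X, continuous g'} ->
  forall x, supp P X x -> g x <= g' x.
Proof.
move=> mX [mg vg] /subspace_continuousP cg [mg' vg'] /subspace_continuousP cg'.
move=> x sx; rewrite leNgt; apply/negP => g'g.
have : \forall y \near within (supp P X) (nbhs x), 0 < g y - g' y.
  apply: (cvgr_gt (g x - g' x)); last by rewrite subr_gt0.
  by apply: cvgB; [exact: cg|exact: cg'].
rewrite near_withinE => /nbhs_ballP[e /= e0 he].
pose B := ball x e `&` supp P X.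
have mB : borel_set B.
  apply: (@measurableI _ (borel 'rV[R]_n)).
    by apply: open_borel; exact: ball_open.
  by apply: closed_borel; exact: supp_closed.
have cB : exists2 K, compact K & B `<=` K.
  exists [set v : 'rV[R]_n |
      forall i, `[x ord0 i - e, x ord0 i + e]%classic (v ord0 i)].
    apply: (@rV_compact _ _ (fun i => `[x ord0 i - e, x ord0 i + e]%classic)).
    by move=> i; exact: segment_compact.
  move=> v [[_ xv] _] i; move: (xv ord0 i).
  rewrite /ball/= /ball_ ltr_distlC => /andP[h1 h2].
  by rewrite /= in_itv/= !ltW.
have mXB : measurable (X @^-1` B) by exact: random_vector_measurable.
have [iU ig eg] := vg _ mB cB; have [_ ig' eg'] := vg' _ mB cB.
have int0 : (\int[P]_(t in X @^-1` B) ((g (X t))%:E - (g' (X t))%:E) = 0)%E.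
  rewrite integralB_EFin// -eg -eg' subee//.
  exact: integrable_fin_num.
have /ae_eq_integral_abs : (\int[P]_(t in X @^-1` B)
    `|((g (X t))%:E - (g' (X t))%:E)| = 0)%E.
  rewrite -[RHS]int0; apply: eq_integral => t; rewrite inE => -[xt st].
  by rewrite gee0_abs// -EFinB lee_fin ltW// he.
move=> /(_ mXB) [|N [mN N0 hN]].
  by apply: measurable_int; exact: integrableB ig ig'.
have PB0 : P (X @^-1` B) = 0%E.
  apply: subset_measure0 N0 => // t [xt st]; apply: hN => /=.
  have /(_ st) := he _ xt.
  by move=> gt0 /(_ (conj xt st)); rewrite -EFinB => -[] /eqP; rewrite gt_eqF.
have /eqP[] := supp_open_neq0 mX sx (ball_open x e) (ballxx x e0).
have mXb : measurable (X @^-1` ball x e).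
  by apply: random_vector_measurable => //; apply: open_borel; exact: ball_open.
have mS : measurable (X @^-1` supp P X).
  apply: random_vector_measurable => //; apply: closed_borel.
  exact: supp_closed.
have mSc : measurable (X @^-1` ~` supp P X).
  by rewrite -preimage_setC; exact: measurableC.
have null : P (X @^-1` B `|` X @^-1` ~` supp P X) = 0%E.
  by rewrite measureU0//; exact: supp_null.
apply: subset_measure0 null => //; first exact: measurableU.
by move=> t xt; have [st|st] := pselect (supp P X (X t)); [left|right].
Qed.

(** Computing [cond_exp] on the support thus amounts to exhibiting one version
    that is continuous there. *)
Lemma cond_expE n (X : T -> 'rV[R]_n) (U : T -> R) (g : 'rV[R]_n -> R) :
  random_vector X ->
  cond_exp_version P X U g -> {within supp P X, continuous g} ->
  {in supp P X, cond_exp P X U =1 g}.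
Proof.
move=> mX vg cg x /set_mem sx; rewrite /cond_exp.
case: xgetP => [_ -> [vg' cg']|/(_ g)/not_andP[]//].
apply/eqP; rewrite eq_le (cond_exp_version_le mX vg' cg' vg cg)//.
exact: (cond_exp_version_le mX vg cg vg' cg').
Qed.

End cond_exp_value.

(** * Products of functions of independent variables *)

Section independence.
Context d d1 d2 (T : measurableType d) (T1 : measurableType d1)
  (T2 : measurableType d2) (R : realType) (P : probability T R).
Variables (A : {mfun T >-> T1}) (X : {mfun T >-> T2}).
Hypothesis AX : forall E F, measurable E -> measurable F ->
  P (A @^-1` E `&` X @^-1` F) = (P (A @^-1` E) * P (X @^-1` F))%E.
Variables (a : T1 -> R) (h : T2 -> R).
Hypotheses (ma : measurable_fun [set: T1] a) (mh : measurable_fun [set: T2] h).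
Hypotheses (ia : P.-integrable [set: T] (fun t => (a (A t))%:E))
  (ih : P.-integrable [set: T] (fun t => (h (X t))%:E)).

Let lawAX : {mfun T >-> (T1 * T2)%type} :=
  mfun_Sub (mem_set
    (measurable_fun_pair (measurable_funPT A) (measurable_funPT X))).

Let f (p : T1 * T2) : \bar R := (a p.1 * h p.2)%:E.

Let mf : measurable_fun setT f.
Proof.
apply/measurable_EFinP; apply: measurable_funM.
- exact: measurableT_comp ma measurable_fst.
- exact: measurableT_comp mh measurable_snd.
Qed.

Let joint_law (S : set (T1 * T2)) : measurable S ->
  (distribution P A \x distribution P X)%E S = distribution P lawAX S.
Proof. by apply: product_measure_unique => E F mE mF; exact: AX. Qed.

Let integral_law (g : T1 * T2 -> \bar R) :
  (\int[(distribution P A \x distribution P X)%E]_p g p = 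
   \int[distribution P lawAX]_p g p)%E.
Proof. by apply: eq_measure_integral => S mS _; exact: joint_law. Qed.

Let integrable_prod :
  (distribution P A \x distribution P X)%E.-integrable setT f.
Proof.
have maE : measurable_fun setT (fun v => `|a v|%:E).
  by apply/measurable_EFinP; exact: measurableT_comp.
have mhE : measurable_fun setT (fun w => `|h w|%:E).
  by apply/measurable_EFinP; exact: measurableT_comp.
apply/integrable12ltyP => //.
under eq_integral => v _.
  under eq_integral => w _ do rewrite /f/= normrM EFinM.
  rewrite ge0_integralZl//; over.
rewrite /= ge0_integralZr//; last exact: integral_ge0.
rewrite (ge0_integral_distribution A maE)// (ge0_integral_distribution X mhE)//.
have /integrableP[_ ltA] := ia; have /integrableP[_ ltX] := ih.
rewrite lte_mul_pinfty ?ge0_fin_numE ?integral_ge0// => t _;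
  exact: normr_ge0.
Qed.

(** By independence the joint law is the product of the laws, where Tonelli's
    theorem evaluates the integral of |a h| as the product of those of |a| and
    |h|. *)
Lemma independent_integrableM :
  P.-integrable [set: T] (fun t => (a (A t) * h (X t))%:E).
Proof.
apply/integrableP; split.
  exact: (measurableT_comp mf (measurable_funPT lawAX)).
have /integrableP[_] := integrable_prod.
by rewrite integral_law ge0_integral_distribution//; exact: measurableT_comp.
Qed.

Lemma independent_integralM :
  (\int[P]_t (a (A t) * h (X t))%:E =
   \int[P]_t (a (A t))%:E * \int[P]_t (h (X t))%:E)%E.
Proof.
have maE : measurable_fun setT (EFin \o a) by exact/measurable_EFinP.
have mhE : measurable_fun setT (EFin \o h) by exact/measurable_EFinP.
rewrite -(@integral_distribution _ _ _ _ _ P lawAX f)//; last first.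
  exact: independent_integrableM.
rewrite -integral_law -integral12_prod_meas1//.
have iA : (distribution P A).-integrable setT (EFin \o a).
  by apply: integrable_pushforward.
have iX : (distribution P X).-integrable setT (EFin \o h).
  by apply: integrable_pushforward.
under eq_integral => v _.
  rewrite /fubini_F; under eq_integral => w _ do rewrite /f/= EFinM.
  rewrite integralZl//; over.
rewrite /=.
rewrite (@integral_distribution _ _ _ _ _ P X (EFin \o h))//.
have /fineK <- : (\int[P]_t (h (X t))%:E)%E \is a fin_num.
  exact: integrable_fin_num.
rewrite integralZr//.
by rewrite (@integral_distribution _ _ _ _ _ P A (EFin \o a)).
Qed.

End independence.

(** * Conditional expectation of separated sums *)

Section continuous_algebra.
Context (R : realType) (V : topologicalType).

Lemma continuous_mul (f g : V -> R) :
  continuous f -> continuous g -> continuous (fun x => f x * g x).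
Proof. by move=> cf cg x; apply: cvgM; [exact: cf|exact: cg]. Qed.

Lemma continuous_subc (f : V -> R) (c : R) :
  continuous f -> continuous (fun x => f x - c).
Proof. by move=> cf x; apply: cvgB; [exact: cf|exact: cvg_cst]. Qed.

Lemma continuous_lin (I : finType) (k : I -> R) (p : I -> V -> R) :
  (forall i, continuous (p i)) -> continuous (fun x => \sum_i k i * p i x).
Proof.
move=> cp x; elim: index_enum => [|i s IH].
  by under eq_fun do rewrite big_nil; exact: cst_continuous.
under eq_fun do rewrite big_cons; apply: cvgD => //.
by apply: cvgM; [exact: cvg_cst|exact: cp].
Qed.

End continuous_algebra.

Section separated.
Context d (T : measurableType d) (R : realType) (P : probability T R).
Context (V V' : ptopologicalType) (A : T -> V) (X : T -> V').
Hypotheses (mA : random_vector A) (mX : random_vector X).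
Hypothesis AX : independent P A X.

Lemma bounded_on_compact_integrable (p : V' -> R) (B K : set V') :
  continuous p -> borel_set B -> compact K -> B `<=` K ->
  P.-integrable (X @^-1` B) (fun t => (p (X t))%:E).
Proof.
move=> cp mB cK BK; have mXB := random_vector_measurable mX mB.
apply: measurable_bounded_integrable => //.
- by rewrite (le_lt_trans (probability_le1 P mXB))// ltry.
- apply: measurable_funTS; apply: (measurableT_comp _ mX).
  exact: continuous_borel_measurable.
- have : bounded_set (p @` K).
    apply: compact_bounded; apply: continuous_compact => //.
    exact: continuous_subspaceT.
  move=> [M [Mr hM]]; exists M; split=> // M' MM' t /= Bt.
  by apply: hM => //; exists (X t) => //; exact: BK.
Qed.

(** Restricting p to B turns p(X) into a bounded variable even when X has no
    moments, and the integral over the event X in B into a full expectation. *)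
Lemma independent_separated (a : V -> R) (p : V' -> R) (B K : set V') :
  measurable_fun [set: borel V] (a : borel V -> R) ->
  P.-integrable [set: T] (fun t => (a (A t))%:E) ->
  continuous p -> borel_set B -> compact K -> B `<=` K ->
  P.-integrable (X @^-1` B) (fun t => (a (A t) * p (X t))%:E) /\
  (\int[P]_(t in X @^-1` B) (a (A t) * p (X t))%:E =
   \int[P]_t (a (A t))%:E * \int[P]_(t in X @^-1` B) (p (X t))%:E)%E.
Proof.
move=> ma ia cp mB cK BK.
have mXB := random_vector_measurable mX mB.
pose h : V' -> R := p \_ B.
have mh : measurable_fun [set: borel V'] (h : borel V' -> R).
  apply/(@measurable_restrictT _ _ (borel V') R B p) => //.
  by apply: measurable_funTS; exact: continuous_borel_measurable.
have hE t : (h (X t))%:E = ((fun t => (p (X t))%:E) \_ (X @^-1` B)) t.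
  rewrite /h !patchE (_ : (t \in X @^-1` B) = (X t \in B)); first by case: ifPn.
  by apply/idP/idP; rewrite !inE.
have ahE t : (a (A t) * h (X t))%:E =
    ((fun t => (a (A t) * p (X t))%:E) \_ (X @^-1` B)) t.
  by rewrite EFinM hE !patchE; case: ifPn => //; rewrite mule0.
have ip : P.-integrable [set: T] (fun t => (h (X t))%:E).
  rewrite (funext hE); apply/(integrable_mkcond _ mXB).
  exact: bounded_on_compact_integrable cp mB cK BK.
pose lA : {mfun T >-> borel V} := mfun_Sub (mem_set mA).
pose lX : {mfun T >-> borel V'} := mfun_Sub (mem_set mX).
split.
  apply/(integrable_mkcond _ mXB); rewrite -(funext ahE).
  exact: (@independent_integrableM _ _ _ _ _ _ _ P lA lX).
rewrite !(integral_mkcond (X @^-1` B)) -(funext ahE) -(funext hE).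
exact: (@independent_integralM _ _ _ _ _ _ _ P lA lX).
Qed.

Lemma cond_exp_version_separated (I : finType) (a : I -> V -> R)
    (p : I -> V' -> R) :
  (forall i, measurable_fun [set: borel V] (a i : borel V -> R)) ->
  (forall i, a i \o A \in Lfun P 1) ->
  (forall i, continuous (p i)) ->
  cond_exp_version P X (fun t => \sum_i a i (A t) * p i (X t))
    (fun x => \sum_i fine 'E_P[a i \o A] * p i x).
Proof.
move=> ma ia cp; split.
  apply: continuous_borel_measurable; exact: continuous_lin.
move=> B mB [K cK BK].
have mXB := random_vector_measurable mX mB.
have ia' i : P.-integrable [set: T] (fun t => (a i (A t))%:E).
  by have /Lfun1_integrable := ia i.
have iap i := (independent_separated (ma i) (ia' i) (cp i) mB cK BK).1.
have eap i := (independent_separated (ma i) (ia' i) (cp i) mB cK BK).2.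
have ip i := bounded_on_compact_integrable (cp i) mB cK BK.
have icp i : P.-integrable (X @^-1` B)
    (fun t => (fine 'E_P[a i \o A] * p i (X t))%:E).
  by under eq_fun do rewrite EFinM; apply: integrableZl => //; exact: ip.
split.
- under eq_fun do rewrite -sumEFin.
  by apply: integrable_sum => // i _; exact: iap.
- under eq_fun do rewrite -sumEFin.
  by apply: integrable_sum => // i _; exact: icp.
- under eq_integral do rewrite -sumEFin.
  under [in RHS]eq_integral do rewrite -sumEFin.
  rewrite !integral_sum//; apply: eq_bigr => i _.
  under [in RHS]eq_integral do rewrite EFinM.
  rewrite integralZl// eap fineK ?expectation_fin_num//.
  by rewrite unlock.
Qed.

End separated.

(** * Covariances of linear combinations *)

Section second_moments.
Context d (T : measurableType d) (R : realType) (P : probability T R).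
Implicit Types (U V : T -> R).

Lemma Lfun2_Lfun1 U : U \in Lfun P 2%:E -> U \in Lfun P 1.
Proof. by apply: Lfun_subset12; exact: fin_num_measure. Qed.

Lemma Lfun2_scaled (k : R) U :
  U \in Lfun P 2%:E -> (fun t => k * U t) \in Lfun P 2%:E.
Proof.
move=> U2; rewrite [X in X \in _](_ : _ = k \o* U).
  by rewrite Lfun_scale// ler1n.
by apply/funext => t; rewrite /= mulrC.
Qed.

Lemma Lfun2_sum (I : Type) (s : seq I) (f : I -> T -> R) :
  (forall i, f i \in Lfun P 2%:E) ->
  (fun t => \sum_(i <- s) f i t) \in Lfun P 2%:E.
Proof.
move=> f2; elim: s => [|i s IH].
  by under eq_fun do rewrite big_nil; exact: Lfun_cst.
under eq_fun do rewrite big_cons.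
by rewrite rpredD ?lee1n//=; exact: f2.
Qed.

Lemma covariance_fin_num2 U V : U \in Lfun P 2%:E -> V \in Lfun P 2%:E ->
  covariance P U V \is a fin_num.
Proof.
move=> U2 V2; apply: covariance_fin_num; [exact: Lfun2_Lfun1..|].
exact: Lfun2_mul_Lfun1.
Qed.

Lemma covariance_scaled_l (k : R) U V :
  U \in Lfun P 2%:E -> V \in Lfun P 2%:E ->
  (covariance P (fun t => k * U t)%R V = k%:E * covariance P U V)%E.
Proof.
move=> U2 V2.
rewrite -covarianceZl; [|exact: Lfun2_Lfun1..|exact: Lfun2_mul_Lfun1].
by congr (covariance _ _ _); apply/funext => t; rewrite /= mulrC.
Qed.

Lemma covariance_sum_l (I : Type) (s : seq I) (f : I -> T -> R) V :
  (forall i, f i \in Lfun P 2%:E) -> V \in Lfun P 2%:E ->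
  covariance P (fun t => \sum_(i <- s) f i t) V =
  (\sum_(i <- s) covariance P (f i) V)%E.
Proof.
move=> f2 V2; elim: s => [|i s IH].
  rewrite big_nil; under eq_fun do rewrite big_nil.
  exact: covariance_cst_l.
rewrite big_cons; under eq_fun do rewrite big_cons.
by rewrite -IH -covarianceDl//; exact: Lfun2_sum.
Qed.

Definition lincomb n (x : 'rV[R]_n) (C : T -> 'rV[R]_n) : T -> R :=
  fun t => (x *m (C t)^T) ord0 ord0.

Lemma lincombE n (x : 'rV[R]_n) (C : T -> 'rV[R]_n) :
  lincomb x C = fun t => \sum_i x ord0 i * C t ord0 i.
Proof.
by apply/funext => t; rewrite /lincomb mxE; apply: eq_bigr => i _; rewrite mxE.
Qed.

Lemma Lfun2_lincomb n (x : 'rV[R]_n) (C : T -> 'rV[R]_n) :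
  finite_second_moments P C -> lincomb x C \in Lfun P 2%:E.
Proof.
by move=> C2; rewrite lincombE; apply: Lfun2_sum => i; exact/Lfun2_scaled/C2.
Qed.

Lemma covariance_lincomb_l n (x : 'rV[R]_n) (C : T -> 'rV[R]_n) V :
  finite_second_moments P C -> V \in Lfun P 2%:E ->
  (covariance P (lincomb x C) V =
   \sum_i (x ord0 i)%:E * covariance P (fun t => C t ord0 i) V)%E.
Proof.
move=> C2 V2; rewrite lincombE covariance_sum_l// => [|i]; last first.
  exact/Lfun2_scaled/C2.
by apply: eq_bigr => i _; rewrite covariance_scaled_l//; exact: C2.
Qed.

(** The bilinear form of the cross-covariance matrix; with C = D it identifies
    the quadratic form of a covariance matrix with a variance. *)
Lemma covariance_lincomb m n (x : 'rV[R]_m) (y : 'rV[R]_n)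
    (C : T -> 'rV[R]_m) (D : T -> 'rV[R]_n) :
  finite_second_moments P C -> finite_second_moments P D ->
  covariance P (lincomb x C) (lincomb y D) =
  ((x *m crosscovmx P C D *m y^T) ord0 ord0)%:E.
Proof.
move=> C2 D2; rewrite covariance_lincomb_l//; last exact: Lfun2_lincomb.
rewrite -mulmxA mxE -sumEFin; apply: eq_bigr => i _.
rewrite EFinM covarianceC covariance_lincomb_l//.
congr (_ * _)%E; rewrite mxE -sumEFin; apply: eq_bigr => j _.
rewrite covarianceC !mxE EFinM fineK ?covariance_fin_num2 ?C2 ?D2//.
by rewrite muleC.
Qed.

(** Cauchy-Schwarz, applied to V and to - V. *)
Lemma covariance_var0 U V : U \in Lfun P 2%:E -> V \in Lfun P 2%:E ->
  'V_P[U] = 0%E -> covariance P U V = 0%E.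
Proof.
move=> U2 V2 U0.
have le0 W : W \in Lfun P 2%:E -> (covariance P U W <= 0)%E.
  by move=> W2; have := covariance_le U2 W2; rewrite U0 sqrte0 mul0e.
apply/eqP; rewrite eq_le le0//= -oppe_le0 -covarianceNr; last first.
- exact: Lfun2_mul_Lfun1.
- exact: Lfun2_Lfun1.
- exact: Lfun2_Lfun1.
- by apply: le0; rewrite rpredN ?lee1n.
Qed.

Lemma expectation_lin (I : finType) (f : I -> T -> R) (k : I -> R) :
  (forall i, f i \in Lfun P 1) ->
  fine 'E_P[fun t => \sum_i f i t * k i] = \sum_i fine 'E_P[f i] * k i.
Proof.
move=> f1; rewrite unlock; under eq_integral do rewrite -sumEFin.
have fi i : P.-integrable [set: T] (fun t => (f i t)%:E).
  exact/Lfun1_integrable.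
rewrite integral_sum//; last first.
  by move=> i; under eq_fun do rewrite EFinM; exact: integrableZr.
rewrite -[RHS]/(fine (_)%:E) -sumEFin; congr fine; apply: eq_bigr => i _.
under eq_integral do rewrite EFinM.
by rewrite integralZr// EFinM fineK// integrable_fin_num.
Qed.

End second_moments.

(** * Conditional variance in the random coefficient model *)

Section freezing.
Context d (T : measurableType d) (R : realType) (P : probability T R).

(** The version of the conditional expectation obtained by integrating over A
    with X frozen at x is a linear combination of the p i, hence continuous. *)
Lemma cond_exp_freeze m n (A : T -> 'rV[R]_m) (X : T -> 'rV[R]_n) (I : finType)
    (a : I -> 'rV[R]_m -> R) (p : I -> 'rV[R]_n -> R) (x : 'rV[R]_n) :
  random_vector A -> random_vector X -> independent P A X ->
  (forall i, continuous (a i)) -> (forall i, a i \o A \in Lfun P 1) ->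
  (forall i, continuous (p i)) -> supp P X x ->
  cond_exp P X (fun t => \sum_i a i (A t) * p i (X t)) x =
  fine 'E_P[fun t => \sum_i a i (A t) * p i x].
Proof.
move=> mA mX AX ca ia cp sx.
rewrite (expectation_lin (fun i => p i x) ia).
have ma i := continuous_borel_measurable (ca i).
rewrite (cond_expE mX (cond_exp_version_separated mA mX AX ma ia cp))//.
- apply: continuous_subspaceT; exact: continuous_lin.
- exact: mem_set.
Qed.

Lemma continuous_vec2_coord n (i : 'I_(1 + n)) :
  continuous (fun x : 'rV[R]_n => vec2 1 x ord0 i).
Proof.
case: (split_ordP i) => j ->.
  by under eq_fun do rewrite /vec2 row_mxEl; exact: cst_continuous.
by under eq_fun do rewrite /vec2 row_mxEr; exact: coord_continuous.
Qed.

(** The conditional mean at x is the number c = E[A.(1, x)].  With c fixed,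
    (U - c)^2 is again a separated sum, so freezing X at x gives
    E[(A.(1, x) - c)^2], a variance because c is the mean. *)
Lemma cond_var_linear n (A : T -> 'rV[R]_(1 + n)) (X : T -> 'rV[R]_n)
    (U : T -> R) (x : 'rV[R]_n) :
  random_vector A -> random_vector X -> independent P A X ->
  finite_second_moments P A ->
  (forall t, U t = (vec2 1 (X t) *m (A t)^T) ord0 ord0) -> supp P X x ->
  cond_var P X U x = fine 'V_P[lincomb (vec2 1 x) A].
Proof.
move=> mA mX AX A2 UE sx.
pose p (i : 'I_(1 + n)) (y : 'rV[R]_n) : R := vec2 1 y ord0 i.
have A1 i := Lfun2_Lfun1 (A2 i).
have ellE (y : 'rV[R]_n) (v : 'rV[R]_(1 + n)) :
    (vec2 1 y *m v^T) ord0 ord0 = \sum_i v ord0 i * p i y.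
  by rewrite mxE; apply: eq_bigr => i _; rewrite [v^T _ _]mxE mulrC.
rewrite /cond_var; set c := cond_exp P X U x.
have cE : c = fine 'E_P[lincomb (vec2 1 x) A].
  rewrite /c (_ : U = fun t => \sum_i A t ord0 i * p i (X t)); last first.
    by apply/funext => t; rewrite UE ellE.
  rewrite (cond_exp_freeze (a := fun i v => v ord0 i) mA mX AX _ A1 _ sx).
  - by congr fine; congr expectation; apply/funext => t; rewrite /lincomb ellE.
  - by move=> i; exact: coord_continuous.
  - by move=> i; exact: continuous_vec2_coord.
(* The first regressor is the constant 1, so c can be absorbed into the first
   coefficient, which makes U - c a linear form in (1, X). *)
pose a i (v : 'rV[R]_(1 + n)) : R := v ord0 i - c * (i == lshift n ord0)%:R.
have sqE (y : 'rV[R]_n) (v : 'rV[R]_(1 + n)) :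
    ((vec2 1 y *m v^T) ord0 ord0 - c) ^+ 2 =
    \sum_(k : 'I_(1 + n) * 'I_(1 + n))
      (a k.1 v * a k.2 v) * (p k.1 y * p k.2 y).
  have -> : (vec2 1 y *m v^T) ord0 ord0 - c = \sum_i a i v * p i y.
    under [RHS]eq_bigr do rewrite mulrBl.
    rewrite sumrB ellE; congr (_ - _).
    rewrite (bigD1 (lshift n ord0))//= big1 => [|i /negPf ->]; last first.
      by rewrite mulr0 mul0r.
    by rewrite ?eqxx !mulr1 addr0 /p /vec2 row_mxEl mxE ?eqxx mulr1.
  rewrite expr2 big_distrlr/= pair_bigA/=.
  by apply: eq_bigr => k _; rewrite mulrACA.
have ca i : continuous (a i).
  by apply: continuous_subc; exact: coord_continuous.
have a2 i : a i \o A \in Lfun P 2%:E.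
  by rewrite (_ : a i \o A =
      (fun t => A t ord0 i) - cst (c * (i == lshift n ord0)%:R))//
    rpredB ?lee1n//= => _; exact: Lfun_cst.
rewrite (_ : (fun t => (U t - c) ^+ 2) =
    fun t => \sum_(k : 'I_(1 + n) * 'I_(1 + n))
    (a k.1 (A t) * a k.2 (A t)) * (p k.1 (X t) * p k.2 (X t))); last first.
  by apply/funext => t; rewrite UE sqE.
rewrite (cond_exp_freeze
    (a := fun k v => a k.1 v * a k.2 v)
    (p := fun k y => p k.1 y * p k.2 y) mA mX AX _ _ _ sx).
- rewrite /variance [in RHS]unlock -cE; congr fine; congr expectation.
  by apply/funext => t; rewrite -sqE expr2.
- by move=> k; exact: continuous_mul.
- by move=> k; exact: (Lfun2_mul_Lfun1 (a2 k.1) (a2 k.2)).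
- by move=> k; apply: continuous_mul; exact: continuous_vec2_coord.
Qed.

End freezing.

(** * Tilting a positive definite form along the binary regressor *)

Section quadratic_forms.
Context (R : realType).

Definition qform n (S : 'M[R]_n) (x : 'rV[R]_n) : R :=
  (x *m S *m x^T) ord0 ord0.

Lemma vec2E q (x : 'rV[R]_(1 + q)) :
  x = vec2 (x ord0 (lshift q ord0)) (rsubmx x).
Proof.
rewrite -{1}(hsubmxK x) /vec2; congr row_mx.
by rewrite [LHS]mx11_scalar mxE.
Qed.

(** With u = e K^-1, where e is the first basis vector, the first coordinate x_0
    of x is x K u^T.  Nonnegativity of the form at x - t u, for
    t = x_0 / (1 + m) and m the value of the form at u, is a Cauchy-Schwarz
    inequality; dividing by 1 + m rather than by m spares the proof that
    m > 0. *)
Lemma qform_full_rank q (K : 'M[R]_(1 + q)) :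
  symmetric_psd K -> \rank K = (1 + q)%N ->
  exists2 l : R, 0 < l &
    forall x : 'rV[R]_(1 + q), l * x ord0 (lshift q ord0) ^+ 2 <= qform K x.
Proof.
move=> [KT K0] rK.
have uK : K \in unitmx by rewrite -row_full_unit /row_full rK.
pose e : 'rV[R]_(1 + q) := delta_mx ord0 (lshift q ord0).
pose u := e *m invmx K.
have uKe : u *m K = e by rewrite mulmxKV.
have eE x : (e *m x^T) ord0 ord0 = x ord0 (lshift q ord0) :> R.
  by rewrite -rowE !mxE.
pose m := qform K u; have m0 : 0 <= m by exact: K0.
exists (1 + m)^-1; first by rewrite invr_gt0 ltr_wpDr.
move=> x; set x0 := x ord0 _; pose t := x0 / (1 + m).
have := K0 (x - t *: u).
have -> : ((x - t *: u) *m K *m (x - t *: u)^T) ord0 ord0 =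
    qform K x - 2 * t * x0 + t ^+ 2 * m.
  have xKu : (x *m K *m u^T) ord0 ord0 = x0.
    by rewrite -mulmxA -{1}KT -trmx_mul uKe trmx_delta -colE mxE.
  have uKx : (u *m K *m x^T) ord0 ord0 = x0 by rewrite uKe eE.
  rewrite [(x - _)^T]linearB/= [(t *: u)^T]linearZ/= !mulmxBl !mulmxBr.
  rewrite -!scalemxAl -!scalemxAr -?scalemxAl.
  have mE (a b c v : 'M[R]_1) :
      (a - t *: b - (t *: c - t *: (t *: v))) ord0 ord0 =
      a ord0 ord0 - t * b ord0 ord0 - t * c ord0 ord0 + t ^+ 2 * v ord0 ord0.
    by rewrite !mxE; ring.
  rewrite mE xKu uKx /m /qform.
  ring.
move=> h; have m1 : 0 < 1 + m by rewrite ltr_wpDr.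
have x0E : x0 = t * (1 + m) by rewrite /t divfK// gt_eqF.
rewrite (_ : _ * _ = t ^+ 2 * (1 + m)); last first.
  by rewrite x0E; field; rewrite gt_eqF.
move: h; rewrite x0E => h; have := sqr_ge0 t; nra.
Qed.

(** The matrix of the map (a, b, c) |-> (a, c) on row vectors. *)
Definition drop_mid q : 'M[R]_(1 + (1 + q), 1 + q) :=
  col_mx (row_mx 1%:M 0) (col_mx 0 (row_mx 0 1%:M)).

Lemma drop_midE q (a b : R) (c : 'rV[R]_q) :
  vec3 a b c *m drop_mid q = vec2 a c.
Proof.
rewrite /vec3 /vec2 /drop_mid !mul_row_col mulmx0 add0r !mul_mx_row.
by rewrite !mulmx1 !mulmx0 add_row_mx addr0 add0r.
Qed.

(** The matrix of (a, b, c) |-> Q(a, c) - l a^2 + l (a - 2 b)^2, with Q the form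
    of K: the correction - 4 l b (a - b) vanishes at a = 1, b in {0, 1}. *)
Definition tilt q (K : 'M[R]_(1 + q)) (l : R) : 'M[R]_(1 + (1 + q)) :=
  let e : 'rV[R]_(1 + q) := vec2 1 0 in
  let f : 'rV[R]_(1 + (1 + q)) := vec3 1 (- 2) 0 in
  drop_mid q *m (K - l *: (e^T *m e)) *m (drop_mid q)^T + l *: (f^T *m f).

Lemma mulmx_vec2 q (a a' : R) (c c' : 'rV[R]_q) :
  vec2 a c *m (vec2 a' c')^T = (a * a')%:M + c *m c'^T.
Proof. by rewrite /vec2 tr_row_mx mul_row_col tr_scalar_mx -scalar_mxM. Qed.

Lemma qform_rank1 n (f x : 'rV[R]_n) :
  qform (f^T *m f) x = ((x *m f^T) ord0 ord0) ^+ 2.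
Proof.
rewrite /qform mulmxA -mulmxA [f *m _](_ : _ = (x *m f^T)^T); last first.
  by rewrite trmx_mul trmxK.
by rewrite [x *m _]mx11_scalar tr_scalar_mx -scalar_mxM !mxE /= expr2 !mulr1n.
Qed.

Lemma qform_lin n (S S' : 'M[R]_n) (l : R) x :
  qform (S + l *: S') x = qform S x + l * qform S' x.
Proof. by rewrite /qform mulmxDr mulmxDl -scalemxAr -scalemxAl !mxE. Qed.

Lemma qform_tilt q (K : 'M[R]_(1 + q)) l a b (c : 'rV[R]_q) :
  qform (tilt K l) (vec3 a b c) =
  qform K (vec2 a c) - l * a ^+ 2 + l * (a - 2 * b) ^+ 2.
Proof.
rewrite /tilt qform_lin qform_rank1 {1}/qform.
rewrite !mulmxA drop_midE -mulmxA -trmx_mul drop_midE -/(qform _ _).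
rewrite -scaleNr qform_lin qform_rank1 mulNr.
have -> : vec2 a c *m (vec2 1 0)^T = a%:M :> 'M[R]_1.
  by rewrite mulmx_vec2 trmx0 mulmx0 addr0 mulr1.
have -> : vec3 a b c *m (vec3 1 (- 2) 0)^T = (a - 2 * b)%:M :> 'M[R]_1.
  rewrite /vec3 !mulmx_vec2 trmx0 mulmx0 addr0 mulr1 -raddfD/=.
  by congr (_%:M); ring.
by rewrite !mxE/= !mulr1n.
Qed.

Lemma tilt_idxB1 q (K : 'M[R]_(1 + q)) l :
  tilt K l (idxB1 q) (idxB1 q) = l * 4.
Proof.
(* The diagonal entry is the value of the form at the basis vector of b. *)
have -> : tilt K l (idxB1 q) (idxB1 q) = qform (tilt K l) (vec3 0 1 0).
  rewrite (_ : vec3 0 1 0 = delta_mx ord0 (idxB1 q)).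
    by rewrite /qform -rowE trmx_delta -colE !mxE.
  apply/rowP => i; rewrite /vec3 /vec2 /idxB1 [RHS]mxE eqxx/=.
  case: (split_ordP i) => j ->.
    by rewrite row_mxEl eq_lrshift ord1 mxE mul0rn.
  rewrite row_mxEr eq_rshift; case: (split_ordP j) => k ->.
    by rewrite row_mxEl eq_lshift !ord1 mxE eqxx.
  by rewrite row_mxEr eq_rlshift mxE.
rewrite qform_tilt (_ : vec2 0 0 = 0); last first.
  by rewrite /vec2 raddf0 row_mx0.
by rewrite /qform !mul0mx mxE; ring.
Qed.

Lemma tilt_psd q (K : 'M[R]_(1 + q)) l : K^T = K -> 0 <= l ->
  (forall x : 'rV[R]_(1 + q), l * x ord0 (lshift q ord0) ^+ 2 <= qform K x) ->
  symmetric_psd (tilt K l).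
Proof.
move=> KT l0 Kl; split.
  rewrite /tilt; set e := vec2 1 0; set f := vec3 1 (- 2) 0.
  have outerT n (g : 'rV[R]_n) : (g^T *m g)^T = g^T *m g.
    by rewrite trmx_mul trmxK.
  rewrite [LHS]linearD/= [(l *: (f^T *m f))^T]linearZ/= outerT.
  congr (_ + _); rewrite !trmx_mul trmxK mulmxA.
  by rewrite [(K - _)^T]linearB/= [(l *: _)^T]linearZ/= outerT KT.
move=> x; rewrite (vec2E x) (vec2E (rsubmx x)) -/(vec3 _ _ _) -/(qform _ _).
rewrite qform_tilt addr_ge0//; last by rewrite mulr_ge0// sqr_ge0.
set a := x _ _; set c := rsubmx _.
by have := Kl (vec2 a c); rewrite subr_ge0 {1}/vec2 row_mxEl mxE mulr1n.
Qed.

End quadratic_forms.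

(** * Second moments of the random coefficients *)

Section coefficients.
Context d (T : measurableType d) (R : realType) (P : probability T R) (q : nat).
Variables (B0 B1 : T -> R) (B2 : T -> 'rV[R]_q).

Let A t := vec3 (B0 t) (B1 t) (B2 t).
Let C t := vec2 (B0 t) (B2 t).

Lemma finite_second_moments_vec2 n (U : T -> R) (D : T -> 'rV[R]_n) :
  finite_second_moments P (fun t => vec2 (U t) (D t)) <->
  U \in Lfun P 2%:E /\ finite_second_moments P D.
Proof.
have UE : (fun t => vec2 (U t) (D t) ord0 (lshift n ord0)) = U.
  by apply/funext => t; rewrite /vec2 row_mxEl mxE mulr1n.
have DE i : (fun t => vec2 (U t) (D t) ord0 (rshift 1 i)) = fun t => D t ord0 i.
  by apply/funext => t; rewrite /vec2 row_mxEr.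
split=> [h|[U2 D2] i].
  by split=> [|i]; [rewrite -UE; exact: h|rewrite -DE; exact: h].
case: (split_ordP i) => j ->; last by rewrite DE; exact: D2.
rewrite (ord1 j).
by rewrite -[X in X \in _]/(fun t => vec2 (U t) (D t) ord0 (lshift n ord0)) UE.
Qed.

Lemma crosscovmx_eq0 : 
  crosscovmx P (fun t => (B1 t)%:M : 'rV[R]_1) B2 = 0 <->
  forall j, fine (covariance P B1 (fun t => B2 t ord0 j)) = 0.
Proof.
have E j : crosscovmx P (fun t => (B1 t)%:M : 'rV[R]_1) B2 ord0 j =
    fine (covariance P B1 (fun t => B2 t ord0 j)).
  rewrite mxE; congr fine; congr (covariance _ _ _).
  by apply/funext => t; rewrite mxE mulr1n.
split=> [h j|h]; first by rewrite -E h mxE.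
by apply/matrixP => i j; rewrite ord1 E h mxE.
Qed.

Lemma lincomb_vec2 n (U : T -> R) (D : T -> 'rV[R]_n) (a : R) (c : 'rV[R]_n) :
  lincomb (vec2 a c) (fun t => vec2 (U t) (D t)) =
  (fun t => a * U t) \+ lincomb c D.
Proof.
apply/funext => t; rewrite /lincomb mulmx_vec2 mxE.
by rewrite [(_%:M) _ _]mxE mulr1n.
Qed.

Hypotheses (B0_L2 : B0 \in Lfun P 2%:E) (B1_L2 : B1 \in Lfun P 2%:E)
  (B2_L2 : finite_second_moments P B2).

Let C_L2 : finite_second_moments P C.
Proof. exact/finite_second_moments_vec2. Qed.

Lemma qform_covmx n (D : T -> 'rV[R]_n) (x : 'rV[R]_n) :
  finite_second_moments P D -> qform (covmx P D) x = fine 'V_P[lincomb x D].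
Proof. by move=> D2; rewrite /variance covariance_lincomb. Qed.

Lemma covmx_psd n (D : T -> 'rV[R]_n) :
  finite_second_moments P D -> symmetric_psd (covmx P D).
Proof.
move=> D2; split; first by apply/matrixP => i j; rewrite !mxE covarianceC.
by move=> x; rewrite -/(qform _ _) qform_covmx// fine_ge0// variance_ge0.
Qed.

Lemma var0_orthogonal : 'V_P[B1] = 0%E ->
  'V_P[B0] = 'V_P[B0 \+ B1] /\
  crosscovmx P (fun t => (B1 t)%:M : 'rV[R]_1) B2 = 0.
Proof.
move=> V0; split.
  by rewrite varianceD// V0 covarianceC covariance_var0// mule0 !adde0.
by apply/crosscovmx_eq0 => j; rewrite covariance_var0//; exact: B2_L2.
Qed.

Hypotheses (eqV : 'V_P[B0] = 'V_P[B0 \+ B1])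
  (cov12 : crosscovmx P (fun t => (B1 t)%:M : 'rV[R]_1) B2 = 0).

Lemma covariance_B1_lincomb (c : 'rV[R]_q) :
  covariance P B1 (lincomb c B2) = 0%E.
Proof.
rewrite covarianceC covariance_lincomb_l// big1// => j _.
rewrite covarianceC -(fineK (covariance_fin_num2 B1_L2 (B2_L2 j))).
by rewrite (crosscovmx_eq0.1 cov12) mule0.
Qed.

(** The combination c^T (B0, B2) has zero variance, so it is uncorrelated with
    B1; only the B0 term contributes, whence Cov(B0, B1) = 0. *)
Lemma kernel_var0 (c : 'cV[R]_(1 + q)) :
  covmx P C *m c = 0 -> c (lshift q ord0) ord0 <> 0 -> 'V_P[B1] = 0%E.
Proof.
move=> Kc c0.
have V0 : 'V_P[lincomb c^T C] = 0%E.
  by rewrite /variance covariance_lincomb// trmxK -mulmxA Kc mulmx0 mxE.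
have /eqP := covariance_var0 (Lfun2_lincomb c^T C_L2) B1_L2 V0.
rewrite (vec2E c^T) /C lincomb_vec2 covarianceDl//; last 2 first.
- exact: Lfun2_scaled.
- exact: Lfun2_lincomb.
rewrite covariance_scaled_l// (covarianceC _ (lincomb _ _)).
rewrite covariance_B1_lincomb.
rewrite adde0 mxE mule_eq0 => /orP[/eqP[]//|/eqP cov01].
move: eqV; rewrite varianceD// cov01 mule0 adde0.
rewrite -(fineK (variance_fin_num B0_L2)) -(fineK (variance_fin_num B1_L2)).
by move=> -[] h; congr (_%:E); lra.
Qed.

(** At z = 1 the coefficient B0 is replaced by B0 + B1, which has the same
    variance and the same covariance with w.B2. *)
Lemma variance_slice (z : R) (w : 'rV[R]_q) : z \in [set 0; 1] ->
  'V_P[lincomb (vec3 1 z w) A] = 'V_P[lincomb (vec2 1 w) C].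
Proof.
have one1 (U : T -> R) : (fun t => 1 * U t) = U.
  by apply/funext => t; rewrite mul1r.
have L2 := Lfun2_lincomb w B2_L2.
rewrite /A /C /vec3 !lincomb_vec2 one1 inE => -[->|->].
  by congr variance; apply/funext => t /=; rewrite mul0r add0r.
rewrite one1.
have -> : B0 \+ (B1 \+ lincomb w B2) = (B0 \+ B1) \+ lincomb w B2.
  by apply/funext => t /=; rewrite addrA.
have B01_L2 : B0 \+ B1 \in Lfun P 2%:E by rewrite rpredD ?lee1n.
rewrite (varianceD B01_L2 L2) (varianceD B0_L2 L2) -eqV covarianceDl//.
by rewrite covariance_B1_lincomb adde0.
Qed.

End coefficients.

(** * Bounds for the variance of the binary regressor's coefficient *)

Theorem proposition5 (R : realType) (d : measure_display) (T : measurableType d)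
    (P : probability T R) (q : nat)
    (B0 B1 : T -> R) (B2 : T -> 'rV[R]_q)
    (Z : T -> R) (W : T -> 'rV[R]_q) (Y : T -> R)
    (A_rv : random_vector (fun t => vec3 (B0 t) (B1 t) (B2 t)))
    (ZW_rv : random_vector (fun t => vec2 (Z t) (W t)))
    (model : forall t, Y t = B0 t + Z t * B1 t + (W t *m (B2 t)^T) ord0 ord0)
    (Z_binary : supp P Z = [set 0; 1])
    (A_ZW_indep : independent P (fun t => vec3 (B0 t) (B1 t) (B2 t))
                                (fun t => vec2 (Z t) (W t)))
    (A_L2 : finite_second_moments P (fun t => vec3 (B0 t) (B1 t) (B2 t)))
    (supp_ZW : supp P (fun t => vec2 (Z t) (W t)) = 
              [set vec2 z w | z in [set 0; 1] & w in supp P W])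
    (supp_W : contains_3pt_product (supp P W)) :
  ('V_P[B0] <> 'V_P[B0 \+ B1] \/
     crosscovmx P (fun t => (B1 t)%:M : 'rV[R]_1) B2 <> 0 ->
   (0 < 'V_P[B1])%E) /\
  ('V_P[B0] = 'V_P[B0 \+ B1] ->
   crosscovmx P (fun t => (B1 t)%:M : 'rV[R]_1) B2 = 0 ->
   let K := covmx P (fun t => vec2 (B0 t) (B2 t)) in
   ((\rank K < 1 + q)%N ->
    (exists c : 'cV[R]_(1 + q), K *m c = 0 /\ c (lshift q ord0) ord0 <> 0) ->
    'V_P[B1] = 0%E) /\
   (\rank K = (1 + q)%N ->
    (0 < ereal_sup [set (S (idxB1 q) (idxB1 q))%:E
                   | S in consistent_cov P Y Z W])%E)).
Proof.
have [B0_L2 /finite_second_moments_vec2[B1_L2 B2_L2]] :=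
  (finite_second_moments_vec2 P _ _).1 A_L2.
have C_L2 : finite_second_moments P (fun t => vec2 (B0 t) (B2 t)).
  exact/finite_second_moments_vec2.
split=> [h|eqV cov12 K].
  rewrite lt_neqAle variance_ge0 andbT; apply/eqP => /esym V0.
  by have [? ?] := var0_orthogonal B0_L2 B1_L2 B2_L2 V0; case: h.
split=> [_ [c [Kc c0]]|rK]; first exact: kernel_var0 eqV cov12 _ Kc c0.
have Kpsd : symmetric_psd K by exact: covmx_psd.
have [l l0 lK] := qform_full_rank Kpsd rK.
apply: (@lt_le_trans _ _ (l * 4)%:E); first by rewrite lte_fin mulr_gt0.
apply: ereal_sup_ubound; exists (tilt K l); last by rewrite tilt_idxB1.
split; first by apply: tilt_psd => //; [exact: Kpsd.1|exact: ltW].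
move=> z w szw.
have z01 : z \in [set 0; 1].
  move: szw; rewrite supp_ZW => -[z' z'01 [w' _ /eq_row_mx[zz' _]]].
  apply/mem_set; have /matrixP/(_ ord0 ord0) := zz'.
  by rewrite !mxE !mulr1n => <-.
rewrite (cond_var_linear A_rv ZW_rv A_ZW_indep A_L2 _ szw); last first.
  move=> t; rewrite model /vec3 !mulmx_vec2 mul1r.
  have addE (M N : 'M[R]_1) : (M + N) ord0 ord0 = M ord0 ord0 + N ord0 ord0.
    by rewrite mxE.
  have scalE (a : R) : (a%:M : 'M[R]_1) ord0 ord0 = a by rewrite mxE mulr1n.
  by rewrite !addE !scalE addrA.
rewrite (variance_slice B0_L2 B1_L2 B2_L2 eqV cov12 w z01).
rewrite -(qform_covmx _ C_L2) -/(qform _ _) qform_tilt -/K.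
(* The correction to the form of K vanishes, since (1 - 2 z)^2 = 1. *)
move: z01; rewrite inE => -[->|->]; ring.
Qed.
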